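(* Let $L$ be a finite atomic lattice with $n$ atoms. If for every bijection $\gamma:\mathcal{A}(L)\to[n]$ the minimal labeling $\lambda_\gamma$ is an $EL$-labeling of $L$, then $L$ is a geometric lattice.
   Context: For a finite poset $P$, $E(P)$ denotes the set of edges (cover relations $x\lessdot y$) of its Hasse diagram. An edge labeling $\lambda:E(P)\to\mathbb{N}$ is an $EL$-labeling if for every interval $[x,y]$ of $P$ there is a unique saturated chain $x=x_1\lessdot x_2\lessdot\cdots\lessdot x_j=y$ whose labels are weakly increasing, $\lambda(x_1,x_2)\le\lambda(x_2,x_3)\le\cdots\le\lambda(x_{j-1},x_j)$, and its label sequence is lexicographically smaller than the label sequence of every other saturated chain in $[x,y]$. An atom of a lattice with minimum $\hat 0$ is an element covering $\hat 0$; $\mathcal{A}(L)$ denotes the set of atoms of $L$. A lattice is atomic if every element is a join of atoms. A finite lattice is geometric if it is atomic and semimodular, where semimodular means it is graded with rank function $\rho$ satisfying $\rho(x\wedge y)+\rho(x\vee y)\le\rho(x)+\rho(y)$ for all $x,y$. For $x\in L$ let $A(x)=\{a\in\mathcal{A}(L): a\le x\}$. For a bijection $\gamma:\mathcal{A}(L)\to[n]=\{1,\dots,n\}$, the minimal labeling $\lambda_\gamma:E(L)\to[n]$ is defined by $\lambda_\gamma(x,y)=\min\bigl(\gamma(A(y))\setminus\gamma(A(x))\bigr)$ for each cover relation $x\lessdot y$. *)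

(* Defs.v *)
From HB Require Import structures.
From mathcomp Require Import all_boot all_order.

Set Implicit Arguments.
Unset Strict Implicit.
Unset Printing Implicit Defensive.

Import Order.Theory Order.SeqLexiSyntax.
Local Open Scope order_scope.

Definition covers (disp : Order.disp_t) (P : finPOrderType disp) : rel P :=
  [rel x y | (x < y) && ~~ [exists z, x < z < y]].

(* The saturated chain x = x_1 <. x_2 <. ... <. x_j = y is represented by x and
   the sequence s = [:: x_2; ...; x_j]. *)
Definition saturated_chain (disp : Order.disp_t) (P : finPOrderType disp)
    (x y : P) (s : seq P) : bool :=
  path (@covers disp P) x s && (last x s == y).

(* An edge labeling is a function of two elements of which only the values on
   cover relations are ever used. *)
Definition labels (disp : Order.disp_t) (P : finPOrderType disp)
    (lambda : P -> P -> nat) (x : P) (s : seq P) : seq nat :=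
  pairmap lambda x s.

(* seqlexi carries the lexicographic order, in which a proper prefix is
   smaller. *)
Definition EL_labeling (disp : Order.disp_t) (P : finPOrderType disp)
    (lambda : P -> P -> nat) : Prop :=
  forall x y : P, x <= y ->
  exists s : seq P,
    [/\ saturated_chain x y s,
        sorted leq (labels lambda x s),
        (forall t : seq P, saturated_chain x y t ->
           sorted leq (labels lambda x t) -> t = s) &
        (forall t : seq P, saturated_chain x y t -> t <> s ->
           (labels lambda x s : seqlexi nat) < labels lambda x t)].

(* finTBLatticeType is the class of nonempty finite lattices. *)
Definition is_atom (disp : Order.disp_t) (L : finTBLatticeType disp) : pred L :=
  fun a => covers \bot a.

Definition atom (disp : Order.disp_t) (L : finTBLatticeType disp) : Type :=
  {a : L | is_atom a}.

HB.instance Definition _ (disp : Order.disp_t) (L : finTBLatticeType disp) :=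
  SubFinite.on (atom L).

Definition atoms_below (disp : Order.disp_t) (L : finTBLatticeType disp)
    (x : L) : {set atom L} :=
  [set a : atom L | val a <= x].

Definition atomic (disp : Order.disp_t) (L : finTBLatticeType disp) : Prop :=
  forall x : L, exists A : {set atom L}, x = \join_(a in A) val a.

Definition rank_function (disp : Order.disp_t) (L : finTBLatticeType disp)
    (rho : L -> nat) : Prop :=
  rho \bot = 0 /\ forall x y : L, covers x y -> rho y = (rho x).+1.

(* L is graded exactly when it has a rank function. *)
Definition semimodular (disp : Order.disp_t) (L : finTBLatticeType disp) : Prop :=
  exists2 rho : L -> nat, rank_function rho &
    forall x y : L, (rho (x `&` y) + rho (x `|` y) <= rho x + rho y)%N.

Definition geometric (disp : Order.disp_t) (L : finTBLatticeType disp) : Prop :=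
  atomic L /\ semimodular L.

(* The element i of 'I_n stands for i + 1 in [n] = {1, ..., n}. As n bounds
   these values, starting from n does not change the minimum of a nonempty set;
   the set is nonempty on every cover relation of an atomic lattice. *)
Definition minimal_labeling (disp : Order.disp_t) (L : finTBLatticeType disp)
    (n : nat) (gamma : atom L -> 'I_n) (x y : L) : nat :=
  \big[minn/n]_(i in (gamma @: atoms_below y) :\: (gamma @: atoms_below x)) i.+1.

(* Main.v *)
Require Import Defs.
From mathcomp Require Import all_boot all_order.
From mathcomp Require Import perm.

(* If [gamma a = 1], the label 1 occurs on every saturated chain from x to
   x \/ a exactly on its last edge, so the weakly increasing chain has a single
   edge: x \/ a covers x for every atom a not below x. Since every cover of x has
   this form, joining with a fixed element maps covers to covers or equalities;
   this yields first the Jordan-Dedekind chain condition and then the rank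
   inequality. *)

Set Implicit Arguments.
Unset Strict Implicit.
Unset Printing Implicit Defensive.

Import Order.Theory.
Local Open Scope order_scope.

Section Covers.
Variables (disp : Order.disp_t) (P : finPOrderType disp).
Implicit Types (x y z : P) (s : seq P).

Lemma covers_lt x y : covers x y -> x < y.
Proof. by case/andP. Qed.

Lemma covers_between x y z : covers x y -> x <= z -> z <= y -> z = x \/ z = y.
Proof.
case/andP=> _ /existsPn/(_ z); rewrite negb_and => nxzy xz zy.
case/orP: nxzy => [nxz|nzy].
  by left; apply/eqP; move: nxz; rewrite lt_neqAle xz andbT negbK eq_sym.
by right; apply/eqP; move: nzy; rewrite lt_neqAle zy andbT negbK.
Qed.

Lemma covers_path_le x s : path (@covers disp P) x s -> x <= last x s.
Proof.
elim: s x => //= y s IHs x /andP[/covers_lt/ltW xy /IHs]; exact: le_trans.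
Qed.

End Covers.

Lemma bigmin_nat_le (I : finType) (A : {pred I}) (F : I -> nat) (m : nat) (i : I) :
  i \in A -> (\big[minn/m]_(j in A) F j <= F i)%N.
Proof.
move=> iA; have := mem_index_enum i.
elim: (index_enum I) => //= j r IHr; rewrite inE big_cons => /predU1P[<-|/IHr ir].
  by rewrite iA geq_minl.
by case: ifP => // _; rewrite geq_min ir orbT.
Qed.

Section AtomicLattice.
Variables (disp : Order.disp_t) (L : finTBLatticeType disp).
Hypothesis atomicL : atomic L.
Implicit Types (x y z : L) (s t : seq L) (a b : atom L).

(** If every atom in a set joining to [y] were below [x], then [y <= x]. *)
Lemma atomic_lt_atom x y : x < y -> exists2 a : atom L, val a <= y & ~~ (val a <= x).
Proof.
move=> xy; have [A defy] := atomicL y.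
have [/existsP[a /andP[aA nax]]|/existsPn nA] :=
    boolP [exists a, (a \in A) && ~~ (val a <= x)].
  by exists a => //; rewrite defy; apply: joins_sup.
suff: y <= x by rewrite (lt_geF xy).
rewrite defy; apply/joinsP => a aA.
by have := nA a; rewrite aA negbK.
Qed.

Section FirstAtom.
Variables (n : nat) (gamma : atom L -> 'I_n) (a : atom L).
Hypotheses (gamma_inj : injective gamma) (gamma_a : gamma a = 0%N :> nat).

Lemma minimal_labeling_first x y :
  ~~ (val a <= x) -> val a <= y -> (minimal_labeling gamma x y <= 1)%N.
Proof.
move=> nax ay.
apply: leq_trans (_ : (gamma a).+1 <= _)%N; last by rewrite gamma_a.
by apply: bigmin_nat_le; rewrite inE !mem_imset // !inE nax.
Qed.

(** By injectivity only [a] gets the value 0, so each atom below [y] carries a label of at least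
    2. *)
Lemma minimal_labeling_not_first x y :
  x < y -> ~~ (val a <= y) -> (1 < minimal_labeling gamma x y)%N.
Proof.
move=> /atomic_lt_atom[b bly _] nay.
have gamma_gt0 c : val c <= y -> (0 < gamma c)%N.
  move=> cy; rewrite lt0n; apply: contra nay => /eqP gc0.
  by rewrite (gamma_inj (_ : gamma a = gamma c)) //; apply: val_inj; rewrite /= gc0.
apply: (big_ind (fun k => 1 < k)%N) => [|k l ? ?|i].
(* The default value [n] exceeds 1 because [0 < gamma b < n]. *)
- exact: leq_ltn_trans (gamma_gt0 b bly) (ltn_ord _).
- by rewrite leq_min; apply/andP.
- by rewrite inE => /andP[_ /imsetP[c]]; rewrite inE => /gamma_gt0 ? ->.
Qed.

Lemma EL_covers_join x :
  EL_labeling (minimal_labeling gamma) -> ~~ (val a <= x) ->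
  covers x (x `|` val a).
Proof.
move=> EL nax; have [s [+ + _ _]] := EL x (x `|` val a) (leUl _ _).
case/lastP: s => [|s y] /andP[/= cs /eqP ls].
  by case/negP: nax; rewrite ls leUr.
(* A single edge is the claim. Otherwise the last two edges, from [w] to [z] to [x \/ a], already
   violate monotonicity. *)
move: cs ls; case/lastP: s => [|s z] /=; first by rewrite andbT => ? <-.
rewrite last_rcons => + ey; rewrite ey !rcons_path !last_rcons -!cats1 -catA /=.
case/andP=> /andP[/covers_path_le xw /covers_lt wz] /covers_lt zy.
rewrite /labels pairmap_cat => /cat_sorted2[_] /=; rewrite andbT leqNgt.
have naz : ~~ (val a <= z).
  apply/negP => az; suff: x `|` val a <= z by rewrite (lt_geF zy).
  by rewrite leUx az (le_trans xw (ltW wz)).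
case/negP; apply: leq_ltn_trans (minimal_labeling_first naz (leUr _ _)) _.
exact: minimal_labeling_not_first.
Qed.

End FirstAtom.

Hypothesis covers_join_atom :
  forall x a, ~~ (val a <= x) -> covers x (x `|` val a).

Lemma covers_atomP x y : covers x y ->
  exists2 a : atom L, ~~ (val a <= x) & y = x `|` val a.
Proof.
move=> cxy; have [a ay nax] := atomic_lt_atom (covers_lt cxy); exists a => //.
have [|||->] := covers_between (z := x `|` val a) cxy => //.
- exact: leUl.
- by rewrite leUx ay ltW // covers_lt.
- by move=> e; case/negP: nax; rewrite -e leUr.
Qed.

(** With [y = x \/ a], the element [y \/ z] is [(x \/ z) \/ a], so all depends on whether [a] lies
    below [x \/ z]. *)
Lemma covers_joinr x y z :
  covers x y -> x `|` z = y `|` z \/ covers (x `|` z) (y `|` z).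
Proof.
case/covers_atomP=> a nax ->; rewrite joinAC.
have [axz|naxz] := boolP (val a <= x `|` z).
  by left; rewrite (join_l axz).
by right; apply: covers_join_atom.
Qed.

(** Joining the cover of [x] by [y] with [z] starts at [z]; if it stayed there, [y] would lie in
    [[x, z]] and equal an endpoint. *)
Lemma covers_join_sibling x y z :
  covers x y -> covers x z -> y != z -> covers z (y `|` z).
Proof.
move=> cxy cxz neq_yz; have xz := ltW (covers_lt cxz).
have [|] := covers_joinr z cxy; rewrite (join_r xz) // => ez.
have yz : y <= z by rewrite ez leUl.
case: (covers_between cxz (ltW (covers_lt cxy)) yz) => [e|/eqP].
  by have := covers_lt cxy; rewrite e ltxx.
by rewrite (negPf neq_yz).
Qed.

Hypothesis saturated_chain_ex :
  forall x y, x <= y -> exists s, saturated_chain x y s.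

(** Jordan-Dedekind condition: if the chains start with distinct covers [s1] and [t1], both tails
    are compared with chains passing through [s1 \/ t1]. *)
Lemma saturated_chain_size x y s t :
  saturated_chain x y s -> saturated_chain x y t -> size s = size t.
Proof.
move=> hs; have [k] := ubnP (size s).
elim: k => // k IHk in x y s t hs *.
case: s hs => [|s1 s] hs.
  case/andP: hs => /= _ /eqP <- _; case: t => //= t1 t /andP[/= /andP[cx ct] /eqP e].
  by have := lt_le_trans (covers_lt cx) (covers_path_le ct); rewrite e ltxx.
rewrite ltnS => szs.
case/andP: hs => /= /andP[cs1 cs] ls.
case: t => [|t1 t].
  case/andP=> /= _ /eqP e.
  have := lt_le_trans (covers_lt cs1) (covers_path_le cs).
  by rewrite (eqP ls) e ltxx.
case/andP=> /= /andP[ct1 ct] lt; congr _.+1.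
have hs : saturated_chain s1 y s by apply/andP.
have ht : saturated_chain t1 y t by apply/andP.
have [e|neq] := eqVneq s1 t1; first by apply: (IHk _ _ _ _ hs); rewrite ?e.
have [|u /andP[cu lu]] := saturated_chain_ex (x := s1 `|` t1) (y := y).
  rewrite leUx -{1}(eqP ls) -(eqP lt).
  by rewrite (covers_path_le cs) (covers_path_le ct).
have hsu : saturated_chain s1 y (s1 `|` t1 :: u).
  by rewrite /saturated_chain /= cu lu joinC (covers_join_sibling ct1 cs1) // eq_sym.
have htu : saturated_chain t1 y (s1 `|` t1 :: u).
  by rewrite /saturated_chain /= cu lu (covers_join_sibling cs1 ct1).
have su := IHk _ _ _ _ hs szs hsu.
(* The induction bounds only the first chain's length; [su] transfers the bound on [s] to the chain
   from [t1] through the join. *)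
by rewrite su; apply: (IHk _ _ _ _ htu); rewrite // -su.
Qed.

Definition chain_rank x : nat := size (xchoose (saturated_chain_ex (le0x x))).

Lemma chain_rankE x s : saturated_chain \bot x s -> chain_rank x = size s.
Proof. by apply: saturated_chain_size; apply: xchooseP. Qed.

Lemma chain_rank_path x s :
  path (@covers disp L) x s -> chain_rank (last x s) = (chain_rank x + size s)%N.
Proof.
move=> cs; have /andP[cx /eqP lx] := xchooseP (saturated_chain_ex (le0x x)).
rewrite {2}/chain_rank -size_cat; apply: chain_rankE.
by rewrite /saturated_chain cat_path cx last_cat lx cs /=.
Qed.

Lemma chain_rank_function : rank_function chain_rank.
Proof.
split=> [|x y cxy]; first exact: (@chain_rankE _ [::] (eqxx _)).
by rewrite -addn1; apply: (@chain_rank_path x [:: y]); rewrite /= cxy.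
Qed.

(** By [covers_joinr], each edge joined with [y] collapses or remains a cover, so it adds at most 1
    to the rank. *)
Lemma chain_rank_join_path x s y : path (@covers disp L) x s ->
  (chain_rank (last x s `|` y) <= chain_rank (x `|` y) + size s)%N.
Proof.
elim: s x => [|z s IHs] x /=; first by rewrite addn0.
case/andP=> cxz /IHs/leq_trans; apply; rewrite addnS -addSn leq_add2r.
have [->//|/chain_rank_function.2->//] := covers_joinr y cxz.
Qed.

Lemma covers_join_atom_semimodular : semimodular L.
Proof.
exists chain_rank; first exact: chain_rank_function.
(* A chain from [x /\ y] to [x] has length equal to the rank difference; joined with [y], it climbs
   from [y] to [x \/ y] in at most that many steps. *)
move=> x y; have [s /andP[cs /eqP ls]] := saturated_chain_ex (leIl x y).
have := chain_rank_join_path y cs; have := chain_rank_path cs.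
rewrite ls meetUK => -> le_r.
by rewrite -addnA leq_add2l addnC.
Qed.

End AtomicLattice.

(** Provides, for each atom, a bijection giving it the label 1, encoded as 0 in the ordinal type. *)
Lemma bijection_to_first (T : finType) (a : T) :
  exists2 gamma : T -> 'I_#|T|, bijective gamma & gamma a = 0%N :> nat.
Proof.
have T_gt0 : (0 < #|T|)%N by apply/card_gt0P; exists a.
exists (tperm (enum_rank a) (Ordinal T_gt0) \o enum_rank) => /=.
  by apply: inj_card_bij; rewrite ?card_ord //; apply: inj_comp;
     [apply: perm_inj | apply: enum_rank_inj].
by rewrite tpermL.
Qed.

Theorem theorem2 (disp : Order.disp_t) (L : finTBLatticeType disp) (n : nat)
    (card_atoms : #|{: atom L}| = n) (atomicL : atomic L)
    (EL : forall gamma : atom L -> 'I_n, bijective gamma ->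
            EL_labeling (minimal_labeling gamma)) :
  geometric L.
Proof.
split=> //; subst n; apply: (covers_join_atom_semimodular atomicL).
  move=> x a; have [gamma gamma_bij gamma_a] := bijection_to_first a.
  exact: EL_covers_join (bij_inj gamma_bij) gamma_a x (EL _ gamma_bij).
move=> x y xy.
(* Any bijection serves here, since an EL-labeling provides a saturated chain in every interval. *)
have [s [? _ _ _]] := EL enum_rank (@enum_rank_bij _) x y xy.
by exists s.
Qed.
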